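(* Let $z\in\mathbb{C}^n$ and $\tilde z=[z^T,1]^T\in\mathbb{C}^{n+1}$. For $i=1,\dots,m$ let $\hat\mu_{d_i}$, $\zeta_{d_i}\ge 0$ and $L_{d_i}\succeq 0$ be given, and let $\mathcal{D}(\hat\mu_{d_i},\zeta_{d_i},L_{d_i})$, $\hat\Gamma_{d_i}$, $\hat J_{d_i}$ be as defined in the context. For any $p_i\in(0,1)$, the distributionally robust complex chance constraint $$\inf_{d_i\sim\mathcal{D}(\hat\mu_{d_i},\zeta_{d_i},L_{d_i})}\mathbb{P}[\mathrm{Re}(d_i\tilde z)\le 0]\ge p_i$$ is equivalent to $$\mathrm{Re}(\hat\mu_{d_i}\tilde z)+\sqrt{\zeta_{d_i}}\sqrt{\tilde z^H\hat\Gamma_{d_i}\tilde z}+\sqrt{\frac{p_i}{1-p_i}}\sqrt{\frac12\left(\tilde z^H\hat\Gamma_{d_i}\tilde z+\mathrm{Re}(\tilde z^T\hat J_{d_i}\tilde z)\right)}\le 0,$$ for $i=1,\dots,m$. If $d_i$ is proper (so that $\hat J_{d_i}=0$), then this inequality reduces to $$\mathrm{Re}(\hat\mu_{d_i}\tilde z)+\left(\sqrt{\zeta_{d_i}}+\sqrt{\frac{p_i}{2(1-p_i)}}\right)\sqrt{\tilde z^H\hat\Gamma_{d_i}\tilde z}\le 0,\qquad i=1,\dots,m.$$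
   Context: $d_i=d_i^R+\mathrm{i}\,d_i^I\in\mathbb{C}^{n+1}$ is a complex random vector with real and imaginary parts $d_i^R,d_i^I$, and $d_i\tilde z=\sum_j(d_i)_j\tilde z_j$ (similarly $\hat\mu_{d_i}\tilde z$, with $\hat\mu_{d_i}\in\mathbb{C}^{n+1}$ a nominal estimate of the mean). $L_{d_i}\in\mathbb{R}^{2(n+1)\times 2(n+1)}$ is a symmetric positive semidefinite matrix partitioned into $(n+1)\times(n+1)$ blocks as $$L_{d_i}=\begin{bmatrix}\hat\Gamma_{d_i^R}&\hat\Gamma_{d_i^R,d_i^I}\\ \hat\Gamma_{d_i^I,d_i^R}&\hat\Gamma_{d_i^I}\end{bmatrix}.$$ Define $$\hat\Gamma_{d_i}=\hat\Gamma_{d_i^R}+\hat\Gamma_{d_i^I}+\mathrm{i}\left(\hat\Gamma_{d_i^I,d_i^R}-\hat\Gamma_{d_i^R,d_i^I}\right),\qquad \hat J_{d_i}=\hat\Gamma_{d_i^R}-\hat\Gamma_{d_i^I}+\mathrm{i}\left(\hat\Gamma_{d_i^I,d_i^R}+\hat\Gamma_{d_i^R,d_i^I}\right),$$ with $\hat\Gamma_{d_i}$ invertible. $\mathcal{D}(\hat\mu_{d_i},\zeta_{d_i},L_{d_i})$ is the set of all probability distributions $F$ of $d_i$ such that $$\big(\mathbb{E}_F[d_i]-\hat\mu_{d_i}\big)^H\hat\Gamma_{d_i}^{-1}\big(\mathbb{E}_F[d_i]-\hat\mu_{d_i}\big)\le\zeta_{d_i}$$ (here $\mathbb{E}_F[d_i]-\hat\mu_{d_i}$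 is read as a column vector) and $$\mathrm{Cov}_F\!\left(\begin{bmatrix}d_i^R\\ d_i^I\end{bmatrix}\right)\preceq L_{d_i}$$ in the Loewner order. The superscript $T$ denotes transpose and $H$ conjugate transpose. A complex random vector is proper when its pseudo-covariance $\mathbb{E}[(d-\mathbb{E}[d])(d-\mathbb{E}[d])^T]$ (for $d$ written as a column) vanishes.
   Formalization: The quadratic form z̃^H Γ̂ z̃ is replaced throughout by z̃^T Γ̂ z̃* (the form of Γ̂ at the conjugate of z̃), because with d_i z̃ unconjugated the printed equivalence is false when the cross block of L is not symmetric. *)

(* Defs.v *)
From HB Require Import structures.
From mathcomp Require Import all_boot all_order all_algebra.
From mathcomp Require Export complex.
From mathcomp Require Import all_classical all_reals all_analysis.

Set Implicit Arguments.
Unset Strict Implicit.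
Unset Printing Implicit Defensive.

Import Order.TTheory GRing.Theory Num.Theory.
Local Open Scope classical_set_scope.
Local Open Scope ring_scope.
Local Open Scope complex_scope.
Local Open Scope sesquilinear_scope.

Section RealMatrices.
Variable R : realType.

Definition psd (k : nat) (A : 'M[R]_k) : Prop :=
  A^T = A /\ forall x : 'cV[R]_k, 0 <= (x^T *m A *m x) 0 0.

Definition loewner_le (k : nat) (A B : 'M[R]_k) : Prop := psd (B - A).

End RealMatrices.

Section ComplexMatrices.
Variable R : realType.

(* The real part of x^H M x. The form is used below with Hermitian matrices
   only, for which x^H M x is already real. *)
Definition hform (k : nat) (M : 'M[R[i]]_k) (x : 'cV[R[i]]_k) : R :=
  complex.Re ((x ^t* *m M *m x) 0 0).

Variable k : nat.
Implicit Type L : 'M[R]_(k + k).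

(* With L partitioned into k x k blocks, ulsubmx, ursubmx, dlsubmx and drsubmx
   are the blocks of indices (R), (R,I), (I,R) and (I) respectively. *)
Definition Gamma L : 'M[R[i]]_k :=
  map_mx (real_complex R) (ulsubmx L + drsubmx L)
  + (0 +i* 1) *: map_mx (real_complex R) (dlsubmx L - ursubmx L).

Definition Jmx L : 'M[R[i]]_k :=
  map_mx (real_complex R) (ulsubmx L - drsubmx L)
  + (0 +i* 1) *: map_mx (real_complex R) (dlsubmx L + ursubmx L).

Definition reim (d : 'rV[R[i]]_k) : 'cV[R]_(k + k) :=
  col_mx (map_mx (@complex.Re R) d)^T (map_mx (@complex.Im R) d)^T.

End ComplexMatrices.

HB.instance Definition _ (R : realType) := isPointed.Build R[i] 0.

(* C^k with the sigma-algebra generated by the real and imaginary parts of the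
   coordinates, i.e. its Borel sigma-algebra. *)
Definition cvec (R : realType) (k : nat) :=
  g_sigma_algebraType
    (\big[setU/set0]_(j < k + k)
       preimage_set_system [set: 'rV[R[i]]_k] (fun d => reim d j 0)
         (@measurable _ (measurableTypeR R))).

Section Laws.
Variables (R : realType) (k : nat).
Implicit Type F : probability (cvec R k) R.

Definition square_integrable F : Prop :=
  forall j : 'I_(k + k), (fun d : cvec R k => reim d j 0) \in Lfun F 2%:E.

Definition Cexpectation F (X : cvec R k -> R[i]) : R[i] :=
  fine ('E_F[fun d => complex.Re (X d)])
  +i* fine ('E_F[fun d => complex.Im (X d)]).

Definition mean F : 'rV[R[i]]_k :=
  \row_j Cexpectation F (fun d => (d : 'rV[R[i]]_k) 0 j).

Definition covmx F : 'M[R]_(k + k) :=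
  \matrix_(j, l) fine (covariance F (fun d => reim d j 0)
                                    (fun d => reim d l 0)).

Definition pseudo_covmx F : 'M[R[i]]_k :=
  \matrix_(j, l) Cexpectation F
    (fun d => ((d : 'rV[R[i]]_k) - mean F) 0 j
              * ((d : 'rV[R[i]]_k) - mean F) 0 l).

Definition proper_law F : Prop := pseudo_covmx F = 0.

(* Square integrability is what makes the covariance matrix meaningful: the
   library's integrals, hence expectations and covariances, are total. *)
Definition ambiguity_set (mu : 'rV[R[i]]_k) (zeta : R) (L : 'M[R]_(k + k)) :
    set (probability (cvec R k) R) :=
  [set F | [/\ square_integrable F,
               hform (invmx (Gamma L)) (mean F - mu)^T <= zeta &
               loewner_le (covmx F) L]].

End Laws.

Definition homogenize (R : realType) (n : nat) (z : 'cV[R[i]]_n) :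
  'cV[R[i]]_(n + 1) := col_mx z 1%:M.

(* Re(d x), for a row d and a column x (no conjugation). *)
Definition Repair (R : realType) (k : nat) (d : 'rV[R[i]]_k)
    (x : 'cV[R[i]]_k) : R := complex.Re ((d *m x) 0 0).

(* The second-order statistics of the scalar d x, for d of covariance L:
   E|dx - E dx|^2 = x^T Gamma x^* and E(dx - E dx)^2 = x^T J x. As d x does not
   conjugate d, the first is the Hermitian form of Gamma = E[(d-E d)(d-E d)^H]
   (d a column) at the entrywise conjugate of x; in general it differs from
   x^H Gamma x, which is E|d^H x - E d^H x|^2. *)
Definition Gammaform (R : realType) (k : nat) (L : 'M[R]_(k + k))
    (x : 'cV[R[i]]_k) : R := hform (Gamma L) (map_mx Num.conj x).

Definition Jform (R : realType) (k : nat) (L : 'M[R]_(k + k))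
    (x : 'cV[R[i]]_k) : R := complex.Re ((x^T *m Jmx L *m x) 0 0).

(* Main.v *)
Require Import Defs.
From HB Require Import structures.
From mathcomp Require Import all_boot all_order all_algebra.
From mathcomp Require Import all_classical all_reals all_analysis.
From mathcomp Require Import measurable_realfun ring lra.

(* With w the real vector (Re x, -Im x), the scalar Re(d x) is the pairing of w
   with (Re d, Im d): its variance is at most w^T L w, which equals half of the
   sum of the forms of Gamma and J at x. By the Cauchy-Schwarz inequality for
   Gamma, its mean exceeds Re(mu x) by at most sqrt zeta * sqrt(x^T Gamma conj(x)).
   Cantelli's inequality then gives sufficiency. For necessity, take the mean
   attaining equality in Cauchy-Schwarz and add xi * L w / sigma, where
   sigma^2 = w^T L w and xi is the centered variable of variance 1 with values
   t and -1/t, for t slightly below sqrt(p / (1 - p)): this law is feasible and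
   violates the chance constraint as soon as the inequality fails. *)

Set Implicit Arguments.
Unset Strict Implicit.

Import Order.TTheory GRing.Theory Num.Theory.
Import numFieldNormedType.Exports.
Local Open Scope classical_set_scope.
Local Open Scope ring_scope.

(** * Complex matrices in real and imaginary coordinates *)

Section ComplexMatrices.
Local Open Scope complex_scope.
Local Open Scope sesquilinear_scope.
Context {R : realType}.

(** Writing every complex matrix as [cmx A B] reduces identities between complex forms to ring
    identities between real bilinear forms. *)
Definition cmx (m n : nat) (A B : 'M[R]_(m, n)) : 'M[R[i]]_(m, n) :=
  \matrix_(i, j) (A i j +i* B i j).

Lemma cmx_ReIm m n (A : 'M[R[i]]_(m, n)) :
  A = cmx (map_mx (@complex.Re R) A) (map_mx (@complex.Im R) A).
Proof. by apply/matrixP => i j; rewrite !mxE; case: (A i j). Qed.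

Lemma Re_cmx m n (A B : 'M[R]_(m, n)) : map_mx (@complex.Re R) (cmx A B) = A.
Proof. by apply/matrixP => i j; rewrite !mxE. Qed.

Lemma Im_cmx m n (A B : 'M[R]_(m, n)) : map_mx (@complex.Im R) (cmx A B) = B.
Proof. by apply/matrixP => i j; rewrite !mxE. Qed.

Lemma Re_cmx_entry m n (A B : 'M[R]_(m, n)) i j :
  complex.Re (cmx A B i j) = A i j.
Proof. by rewrite mxE. Qed.

Lemma tr_cmx m n (A B : 'M[R]_(m, n)) : (cmx A B)^T = cmx A^T B^T.
Proof. by apply/matrixP => i j; rewrite !mxE. Qed.

Lemma conj_cmx m n (A B : 'M[R]_(m, n)) : map_mx Num.conj (cmx A B) = cmx A (- B).
Proof. by apply/matrixP => i j; rewrite !mxE. Qed.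

Lemma conj_conj_tr m n (A : 'M[R[i]]_(m, n)) : (map_mx Num.conj A) ^t* = A^T.
Proof. by apply/matrixP => i j; rewrite !mxE conjCK. Qed.

Lemma addcmx m n (A B C D : 'M[R]_(m, n)) :
  cmx A B + cmx C D = cmx (A + C) (B + D).
Proof. by apply/matrixP => i j; rewrite !mxE. Qed.

Lemma scalecmx m n t (A B : 'M[R]_(m, n)) :
  t%:C *: cmx A B = cmx (t *: A) (t *: B).
Proof.
by apply/matrixP => i j; rewrite !mxE; apply/eqP; rewrite eq_complex /=;
  apply/andP; split; apply/eqP; ring.
Qed.

Lemma sum_complex (I : Type) (r : seq I) (F G : I -> R) :
  \sum_(i <- r) (F i +i* G i) = (\sum_(i <- r) F i) +i* (\sum_(i <- r) G i).
Proof.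
by elim: r => [|i r IH]; rewrite ?big_nil// !big_cons IH.
Qed.

Lemma mulcmx m n p (A B : 'M[R]_(m, n)) (C D : 'M[R]_(n, p)) :
  cmx A B *m cmx C D = cmx (A *m C - B *m D) (A *m D + B *m C).
Proof.
apply/matrixP => i j; rewrite !mxE.
under eq_bigr do rewrite !mxE.
by rewrite sum_complex -sumrN -!big_split.
Qed.

Lemma GammaE k (L : 'M[R]_(k + k)) :
  Gamma L = cmx (ulsubmx L + drsubmx L) (dlsubmx L - ursubmx L).
Proof.
by apply/matrixP => i j; rewrite !mxE; apply/eqP; rewrite eq_complex /=;
  apply/andP; split; apply/eqP; ring.
Qed.

Lemma JmxE k (L : 'M[R]_(k + k)) :
  Jmx L = cmx (ulsubmx L - drsubmx L) (dlsubmx L + ursubmx L).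
Proof.
by apply/matrixP => i j; rewrite !mxE; apply/eqP; rewrite eq_complex /=;
  apply/andP; split; apply/eqP; ring.
Qed.

End ComplexMatrices.

(** * The forms of [L], [Gamma] and [Jmx], and Cauchy-Schwarz inequalities *)

Section QuadraticForms.
Local Open Scope complex_scope.
Local Open Scope sesquilinear_scope.
Context {R : realType}.

Lemma entryD m n (A B : 'M[R]_(m, n)) i j : (A + B) i j = A i j + B i j.
Proof. by rewrite mxE. Qed.

Lemma entryN m n (A : 'M[R]_(m, n)) i j : (- A) i j = - A i j.
Proof. by rewrite mxE. Qed.

Lemma entryZ m n c (A : 'M[R]_(m, n)) i j : (c *: A) i j = c * A i j.
Proof. by rewrite mxE. Qed.

Definition bform k (A : 'M[R]_k) (x y : 'cV[R]_k) : R := (x^T *m A *m y) 0 0.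
Definition qform k (A : 'M[R]_k) (x : 'cV[R]_k) : R := bform A x x.

Lemma bform_tr k (A : 'M[R]_k) x y : bform A x y = bform A^T y x.
Proof.
transitivity ((x^T *m A *m y)^T 0 0); first by rewrite [RHS]mxE.
by rewrite !trmx_mul trmxK mulmxA.
Qed.

Lemma bformDl k (A : 'M[R]_k) x1 x2 y :
  bform A (x1 + x2) y = bform A x1 y + bform A x2 y.
Proof. by rewrite /bform linearD !mulmxDl mxE. Qed.

Lemma bformDr k (A : 'M[R]_k) x y1 y2 :
  bform A x (y1 + y2) = bform A x y1 + bform A x y2.
Proof. by rewrite /bform !mulmxDr mxE. Qed.

Lemma bformZl k (A : 'M[R]_k) t x y : bform A (t *: x) y = t * bform A x y.
Proof. by rewrite /bform linearZ -!scalemxAl mxE. Qed.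

Lemma bformZr k (A : 'M[R]_k) t x y : bform A x (t *: y) = t * bform A x y.
Proof. by rewrite /bform -!scalemxAr mxE. Qed.

Lemma bformNl k (A : 'M[R]_k) x y : bform A (- x) y = - bform A x y.
Proof. by rewrite -scaleN1r bformZl mulN1r. Qed.

Lemma bformNr k (A : 'M[R]_k) x y : bform A x (- y) = - bform A x y.
Proof. by rewrite -scaleN1r bformZr mulN1r. Qed.

Lemma bformDm k (A B : 'M[R]_k) x y :
  bform (A + B) x y = bform A x y + bform B x y.
Proof. by rewrite /bform mulmxDr mulmxDl mxE. Qed.

Lemma bformNm k (A : 'M[R]_k) x y : bform (- A) x y = - bform A x y.
Proof. by rewrite /bform mulmxN mulNmx mxE. Qed.

Lemma bform_col k (L : 'M[R]_(k + k)) a b c d :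
  bform L (col_mx a b) (col_mx c d) =
  bform (ulsubmx L) a c + bform (ursubmx L) a d
  + (bform (dlsubmx L) b c + bform (drsubmx L) b d).
Proof.
rewrite /bform -[in LHS](submxK L) tr_col_mx mul_row_block mul_row_col.
by rewrite !mulmxDl !entryD; ring.
Qed.

Lemma hform_cmx k (P Q : 'M[R]_k) a b :
  hform (cmx P Q) (cmx a b) =
  bform P a a + bform P b b + bform Q b a - bform Q a b.
Proof.
rewrite /hform tr_cmx conj_cmx !mulcmx Re_cmx_entry.
rewrite !mulmxBl !mulmxDl !(mulNmx, mulmxN, entryD, entryN).
by rewrite /bform; ring.
Qed.

Lemma Re_sesqui_cmx k (P Q : 'M[R]_k) a b c d :
  complex.Re (((cmx a b) ^t* *m cmx P Q *m cmx c d) 0 0) =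
  bform P a c + bform P b d + bform Q b c - bform Q a d.
Proof.
rewrite tr_cmx conj_cmx !mulcmx Re_cmx_entry.
rewrite !mulmxBl !mulmxDl !(mulNmx, mulmxN, entryD, entryN).
by rewrite /bform; ring.
Qed.

(** The vector [col_mx (- b) a] holds the real coordinates of i(a + ib), so the form of [Gamma L] at
    y is the form of [L] at y plus that at iy. Positivity of [L] thereby passes to [Gamma L]. *)
Lemma hform_Gamma k (L : 'M[R]_(k + k)) a b :
  hform (Gamma L) (cmx a b) = qform L (col_mx a b) + qform L (col_mx (- b) a).
Proof.
rewrite GammaE hform_cmx /qform !bform_col.
by rewrite !(bformDm, bformNm, bformNl, bformNr); ring.
Qed.

(** Let x = a + ib and let q be the form of [L]. Then [Gammaform] is q(a, -b) + q(b, a) and [Jform]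
    is q(a, -b) - q(b, a). When [L] is the covariance of d, these two values of q are the variances
    of Re(d x) and Im(d x). *)
Lemma Gamma_Jform k (L : 'M[R]_(k + k)) (x : 'cV[R[i]]_k) : L^T = L ->
  Gammaform L x + Jform L x = 2 * qform L (reim (map_mx Num.conj x)^T).
Proof.
move=> Lsym; rewrite (cmx_ReIm x).
set a := map_mx _ x; set b := map_mx _ x.
rewrite /Gammaform /reim conj_cmx tr_cmx Re_cmx Im_cmx !trmxK.
rewrite hform_Gamma /Jform.
(* The transpose of x is the conjugate transpose of conj x, so the form of [Jmx L] becomes a
   sesquilinear one. *)
have -> : complex.Re (((cmx a b)^T *m Jmx L *m cmx a b) 0 0) =
   complex.Re (((cmx a (- b)) ^t* *m Jmx L *m cmx a b) 0 0).
  by rewrite !tr_cmx conj_cmx linearN/= opprK.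
rewrite JmxE Re_sesqui_cmx /qform !bform_col.
rewrite !(bformDm, bformNm, bformNl, bformNr).
have -> : bform (ursubmx L) a b = bform (dlsubmx L) b a.
  by rewrite bform_tr trmx_ursub Lsym.
have -> : bform (dlsubmx L) a b = bform (ursubmx L) b a.
  by rewrite bform_tr trmx_dlsub Lsym.
by ring.
Qed.

(** For c > 0 the quadratic is evaluated at its minimizer -b / c. For c = 0 it is affine, and b must
    vanish, since otherwise the value -1 would be taken. *)
Lemma discriminant_le (a b c : R) : 0 <= c ->
  (forall t, 0 <= a + 2 * b * t + c * t ^+ 2) -> b ^+ 2 <= a * c.
Proof.
rewrite le_eqVlt => /predU1P[<-|c0] h.
  have [->|b0] := eqVneq b 0; first by rewrite expr0n mulr0.
  have := h (- (a + 1) / (2 * b)).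
  have -> : a + 2 * b * (- (a + 1) / (2 * b)) + 0 * (- (a + 1) / (2 * b)) ^+ 2 = -1.
    by field.
  by rewrite ler0N1.
have := h (- b / c).
have -> : a + 2 * b * (- b / c) + c * (- b / c) ^+ 2 = a - b ^+ 2 / c.
  by field; rewrite gt_eqF.
by rewrite subr_ge0 ler_pdivrMr.
Qed.

Lemma psd_CauchySchwarz k (A : 'M[R]_k) x y : psd A ->
  bform A x y ^+ 2 <= qform A x * qform A y.
Proof.
move=> [Asym Age0]; apply: discriminant_le; first exact: Age0.
move=> t; have := Age0 (x + t *: y); rewrite -/(bform _ _ _).
rewrite !(bformDl, bformDr, bformZl, bformZr) (bform_tr A y) Asym /qform.
by congr (_ <= _); ring.
Qed.

Lemma hform_Gamma_ge0 k (L : 'M[R]_(k + k)) y : psd L -> 0 <= hform (Gamma L) y.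
Proof. by move=> [_ Lge0]; rewrite (cmx_ReIm y) hform_Gamma addr_ge0 // Lge0. Qed.

(** Real multiples of y suffice because only the real part of the sesquilinear form is bounded: the
    form at u + t y is a nonnegative quadratic in the real t. *)
Lemma Gamma_CauchySchwarz k (L : 'M[R]_(k + k)) y u : psd L ->
  complex.Re ((y ^t* *m Gamma L *m u) 0 0) ^+ 2
    <= hform (Gamma L) u * hform (Gamma L) y.
Proof.
move=> Lpsd; apply: discriminant_le; first exact: hform_Gamma_ge0.
move=> t; have := hform_Gamma_ge0 (u + t%:C *: y) Lpsd.
case: Lpsd => Lsym _.
rewrite (cmx_ReIm u) (cmx_ReIm y) scalecmx addcmx GammaE !hform_cmx Re_sesqui_cmx.
set a := map_mx _ u; set b := map_mx _ u; set c := map_mx _ y; set d := map_mx _ y.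
(* [Gamma L] is Hermitian: its real part is symmetric and its imaginary part antisymmetric, so the
   two cross terms of the expansion coincide. *)
have symP v w : bform (ulsubmx L + drsubmx L) v w = bform (ulsubmx L + drsubmx L) w v.
  by rewrite bform_tr linearD/= trmx_ulsub trmx_drsub Lsym.
have symQ v w : bform (dlsubmx L - ursubmx L) v w = - bform (dlsubmx L - ursubmx L) w v.
  by rewrite bform_tr linearB/= trmx_dlsub trmx_ursub Lsym -bformNm opprB.
rewrite !(bformDl, bformDr, bformZl, bformZr).
rewrite (symP a c) (symP b d) (symQ a d) (symQ b c).
by congr (_ <= _); ring.
Qed.

Lemma Gamma_herm k (L : 'M[R]_(k + k)) : L^T = L -> (Gamma L) ^t* = Gamma L.
Proof.
move=> Lsym; rewrite GammaE tr_cmx conj_cmx; congr cmx.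
  by rewrite linearD/= trmx_ulsub trmx_drsub Lsym.
by rewrite linearB/= trmx_dlsub trmx_ursub Lsym opprB.
Qed.

Lemma hform_invGamma k (L : 'M[R]_(k + k)) v : L^T = L -> Gamma L \in unitmx ->
  hform (invmx (Gamma L)) (Gamma L *m v) = hform (Gamma L) v.
Proof.
move=> Lsym Gu; rewrite /hform trmx_mul map_mxM Gamma_herm//.
by rewrite -mulmxA mulKmx// mulmxA.
Qed.

(* Re(v x) is the Gamma-inner product of conj x and Gamma^-1 v^T. *)
Lemma Repair_le k (L : 'M[R]_(k + k)) (v : 'rV[R[i]]_k) x zeta :
    psd L -> Gamma L \in unitmx -> hform (invmx (Gamma L)) v^T <= zeta ->
  Repair v x <= Num.sqrt zeta * Num.sqrt (Gammaform L x).
Proof.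
move=> Lpsd Gu; set u := invmx (Gamma L) *m v^T.
have vE : v^T = Gamma L *m u by rewrite mulKVmx.
rewrite vE hform_invGamma//; last by case: Lpsd.
move=> uz.
have z0 : 0 <= zeta := le_trans (hform_Gamma_ge0 u Lpsd) uz.
have -> : Repair v x =
    complex.Re (((map_mx Num.conj x) ^t* *m Gamma L *m u) 0 0).
  rewrite /Repair -mulmxA -vE; congr (complex.Re _).
  by rewrite conj_conj_tr -trmx_mul [RHS]mxE.
rewrite -sqrtrM// (le_trans (ler_norm _))// -sqrtr_sqr ler_wsqrtr//.
rewrite (le_trans (Gamma_CauchySchwarz _ _ Lpsd))// ler_wpM2r//.
exact: hform_Gamma_ge0.
Qed.

(** Equality holds in the Cauchy-Schwarz inequality when Gamma^-1 v^T is a nonnegative multiple of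
    conj x. *)
Lemma Repair_attained k (L : 'M[R]_(k + k)) (x : 'cV[R[i]]_k) zeta :
    psd L -> Gamma L \in unitmx -> 0 <= zeta ->
  exists v : 'rV[R[i]]_k, hform (invmx (Gamma L)) v^T <= zeta /\
    Repair v x = Num.sqrt zeta * Num.sqrt (Gammaform L x).
Proof.
move=> Lpsd Gu z0; set y := map_mx Num.conj x.
set g := Gammaform L x; have g0 : 0 <= g by exact: hform_Gamma_ge0.
(* This scale gives t^2 g = zeta when g is nonzero. When g = 0, division by zero yields t = 0, hence
   v = 0, and both sides of the equality vanish. *)
pose t := Num.sqrt zeta / Num.sqrt g.
exists (Gamma L *m (t%:C *: y))^T; rewrite trmxK; split.
  rewrite hform_invGamma//; last by case: Lpsd.
  have -> : hform (Gamma L) (t%:C *: y) = t ^+ 2 * g.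
    rewrite /g /Gammaform -/y (cmx_ReIm y) scalecmx GammaE !hform_cmx.
    by rewrite !(bformZl, bformZr); ring.
  rewrite /t expr_div_n !sqr_sqrtr//.
  have [->|gn0] := eqVneq g 0; first by rewrite mulr0.
  by rewrite divfK.
have -> : Repair (Gamma L *m (t%:C *: y))^T x = t * g.
  rewrite /Repair.
  have -> : ((Gamma L *m (t%:C *: y))^T *m x) 0 0 = t%:C * (y ^t* *m Gamma L *m y) 0 0.
    have <- : (((Gamma L *m (t%:C *: y))^T *m x)^T) 0 0 = ((Gamma L *m (t%:C *: y))^T *m x) 0 0.
      by rewrite mxE.
    by rewrite trmx_mul trmxK -conj_conj_tr -scalemxAr -scalemxAr mxE mulmxA.
  rewrite /g /Gammaform /hform -/y.
  by case: ((_ *m y) 0 0) => a b /=; rewrite mul0r subr0.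
have [g00|gn0] := eqVneq g 0; first by rewrite g00 sqrtr0 !mulr0.
by rewrite /t -[in X in _ * X](sqr_sqrtr g0) expr2 mulrA divfK// sqrtr_eq0 -ltNge lt_def gn0.
Qed.

Lemma RepairE k (d : 'rV[R[i]]_k) (x : 'cV[R[i]]_k) :
  Repair d x = ((reim (map_mx Num.conj x)^T)^T *m reim d) 0 0.
Proof.
rewrite /Repair (cmx_ReIm d) (cmx_ReIm x).
set a := map_mx _ x; set b := map_mx _ x; set c := map_mx _ d; set e := map_mx _ d.
rewrite conj_cmx tr_cmx /reim !Re_cmx !Im_cmx !trmxK mulcmx Re_cmx_entry.
have tr u v : (v^T *m u^T) 0 0 = (u *m v) 0 0 :> R by rewrite -trmx_mul mxE.
by rewrite tr_col_mx mul_row_col linearN/= mulNmx !(entryD, entryN) !tr.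
Qed.

End QuadraticForms.

(** * Moments of linear combinations and Cantelli's inequality *)

Section RandomVariables.
Context {d : measure_display} {T : measurableType d} {R : realType}.
Variable P : probability T R.

Lemma Lfun21 (X : T -> R) : X \in Lfun P 2%:E -> X \in Lfun P 1.
Proof. by apply: Lfun_subset12; exact: fin_num_measure. Qed.

Lemma Lfun2D (X Y : T -> R) :
  X \in Lfun P 2%:E -> Y \in Lfun P 2%:E -> X \+ Y \in Lfun P 2%:E.
Proof. by move=> X2 Y2; rewrite rpredD// lee1n. Qed.

Lemma Lfun2Z (c : R) (X : T -> R) : X \in Lfun P 2%:E -> c \o* X \in Lfun P 2%:E.
Proof. by apply: Lfun_scale; rewrite ler1n. Qed.

Lemma Lfun2M (X Y : T -> R) :
  X \in Lfun P 2%:E -> Y \in Lfun P 2%:E -> (X * Y)%R \in Lfun P 1.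
Proof. exact: Lfun2_mul_Lfun1. Qed.

Section LinearCombinations.
Variables (I : eqType) (X : I -> T -> R) (w : I -> R).
Hypothesis X2 : forall j, X j \in Lfun P 2%:E.

Let lincomb (r : seq I) (t : T) : R := \sum_(j <- r) w j * X j t.

Let lincomb_nil : lincomb [::] = cst 0.
Proof. by apply/funext => t; rewrite /lincomb big_nil. Qed.

Let lincomb_cons j r : lincomb (j :: r) = (w j \o* X j) \+ lincomb r.
Proof. by apply/funext => t; rewrite /lincomb big_cons /= mulrC. Qed.

Lemma Lfun2_lincomb r : lincomb r \in Lfun P 2%:E.
Proof.
elim: r => [|j r IH]; first by rewrite lincomb_nil Lfun_cst.
by rewrite lincomb_cons Lfun2D// Lfun2Z.
Qed.

Lemma expectation_lincomb r :
  fine 'E_P[lincomb r] = \sum_(j <- r) w j * fine 'E_P[X j].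
Proof.
elim: r => [|j r IH]; first by rewrite lincomb_nil expectation_cst big_nil.
have Xj1 := Lfun21 (X2 j); have L1 := Lfun21 (Lfun2_lincomb r).
rewrite lincomb_cons expectationD//; last exact/Lfun21/Lfun2Z.
rewrite expectationZl// fineD ?fin_numM ?expectation_fin_num//.
by rewrite fineM ?expectation_fin_num// IH big_cons.
Qed.

Lemma covariance_lincomb r (Z : T -> R) : Z \in Lfun P 2%:E ->
  fine (covariance P (lincomb r) Z) = \sum_(j <- r) w j * fine (covariance P (X j) Z).
Proof.
move=> Z2; elim: r => [|j r IH]; first by rewrite lincomb_nil covariance_cst_l big_nil.
have L2 := Lfun2_lincomb r.
have cov_fin (U : T -> R) : U \in Lfun P 2%:E -> covariance P U Z \is a fin_num.
  by move=> U2; rewrite covariance_fin_num ?Lfun2M// Lfun21.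
rewrite lincomb_cons covarianceDl//; last exact: Lfun2Z.
rewrite covarianceZl ?Lfun2M ?Lfun21//.
rewrite fineD ?fin_numM ?cov_fin//.
by rewrite fineM ?cov_fin// IH big_cons.
Qed.

Lemma variance_lincomb r : fine 'V_P[lincomb r] =
  \sum_(j <- r) \sum_(l <- r) w j * w l * fine (covariance P (X j) (X l)).
Proof.
rewrite /variance covariance_lincomb ?Lfun2_lincomb//.
apply: eq_bigr => j _; rewrite covarianceC covariance_lincomb// mulr_sumr.
by apply: eq_bigr => l _; rewrite covarianceC mulrA.
Qed.

End LinearCombinations.

(** The nonnegative function (X - c)^2 has integral zero, so it vanishes almost everywhere. *)
Lemma variance0_ae (X : T -> R) : X \in Lfun P 2%:E -> fine 'V_P[X] = 0 ->
  {ae P, forall t, X t = fine 'E_P[X]}.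
Proof.
move=> X2; set c := fine 'E_P[X] => V0.
have {}V0 : ('V_P[X] = 0)%E by rewrite -[LHS]fineK ?V0// variance_fin_num.
have Y2 : X \- cst c \in Lfun P 2%:E.
  have -> : X \- cst c = X \+ cst (- c) by [].
  by rewrite Lfun2D// Lfun_cst.
have mY2 : measurable_fun setT (fun t => ((X t - c) ^+ 2)%:E : \bar R).
  exact: measurable_int (Lfun2_integrable_sqr Y2).
have : (\int[P]_t `|((X t - c) ^+ 2)%:E| = 0)%E.
  rewrite -[RHS]V0 /variance unlock -/c unlock; apply: eq_integral => t _.
  rewrite gee0_abs ?lee_fin ?sqr_ge0// expr2.
move/(ae_eq_integral_abs _ measurableT mY2).
apply: negligibleS => t /= Xtc; apply: contra_not Xtc => /(_ I)[] /eqP.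
by rewrite sqrf_eq0 subr_eq0 => /eqP.
Qed.

(** With c the mean and v the variance, Cantelli's inequality at deviation -c bounds the probability
    of X >= 0 by v / (v + c^2). Squaring the hypothesis gives kappa^2 v <= c^2, which makes this at
    most 1 / (1 + kappa^2). *)
Lemma robust_cantelli (X : T -> R) (kappa : R) : X \in Lfun P 2%:E -> 0 < kappa ->
    fine 'E_P[X] + kappa * Num.sqrt (fine 'V_P[X]) <= 0 ->
  ((kappa ^+ 2 / (1 + kappa ^+ 2))%:E <= P [set t | (X t <= 0)%R])%E.
Proof.
move=> X2 k0; set c := fine 'E_P[X]; set v := fine 'V_P[X] => h.
have v0 : 0 <= v by rewrite fine_ge0// variance_ge0.
have mX : measurable_fun setT X by case/andP: X2; rewrite inE.
have cE : ('E_P[X] = c%:E)%E by rewrite fineK// expectation_fin_num// Lfun21.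
have D0 : 0 < 1 + kappa ^+ 2 by rewrite ltr_wpDr ?exprn_ge0// ltW.
have mneg : measurable [set t | X t <= 0].
  rewrite -[X in measurable X]setTI (_ : [set t | _] = X @^-1` `]-oo, 0]).
    exact: mX.
  by apply/seteqP; split=> t /=; rewrite in_itv.
have mpos : measurable [set t | 0 < X t].
  rewrite (_ : [set t | _] = ~` [set t | X t <= 0]); first exact: measurableC.
  by apply/seteqP; split=> t /=; rewrite ltNge => /negP.
have -> : [set t | X t <= 0] = ~` [set t | 0 < X t].
  by apply/seteqP; split=> t /=; rewrite leNgt => /negP.
have -> : kappa ^+ 2 / (1 + kappa ^+ 2) = 1 - (1 + kappa ^+ 2)^-1.
  by field; rewrite gt_eqF.
rewrite probability_setC// EFinB leeB//.
(* Cantelli's inequality needs -c > 0. This follows from the hypothesis if v > 0, but c may be 0 if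
   v = 0; in that case X equals c <= 0 almost surely. *)
have [v00|vn0] := eqVneq v 0.
  have -> : P [set t | 0 < X t] = 0%E.
    apply/(negligibleP _ mpos).
    apply: negligibleS (variance0_ae X2 v00) => t /= Xt0 Xtc.
    move: h Xt0; rewrite v00 sqrtr0 mulr0 addr0 Xtc -/c => c0.
    by rewrite ltNge c0.
  by rewrite lee_fin invr_ge0 ltW.
have vp : 0 < v by rewrite lt_def vn0.
have c0 : c < 0.
  have : 0 < kappa * Num.sqrt v by rewrite mulr_gt0 ?sqrtr_gt0.
  lra.
have nc0 : 0 < - c by rewrite oppr_gt0.
have PA : (P [set t | (- c)%:E <= (X t)%:E - 'E_P[X]] <=
    (v / (v + (- c) ^ 2))%:E)%E := @cantelli _ _ _ P (mfun_Sub (mem_set mX)) (- c) X2 nc0.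
rewrite cE in PA.
have AE : [set t | ((- c)%:E <= (X t)%:E - c%:E)%E] = [set t | 0 <= X t].
  by apply/seteqP; split=> t /=; rewrite -EFinB lee_fin lerBrDr addNr.
rewrite AE -exprnP sqrrN in PA.
apply: le_trans (le_trans PA _).
  apply: le_measure; rewrite ?inE//; last by move=> t /= /ltW.
  rewrite -[X in measurable X]setTI (_ : [set t | _] = X @^-1` `[0, +oo[).
    exact: mX.
  by apply/seteqP; split=> t /=; rewrite in_itv/= andbT.
have c2 : v * kappa ^+ 2 <= c ^+ 2.
  have : (kappa * Num.sqrt v) ^+ 2 <= (- c) ^+ 2.
    rewrite lerXn2r// ?nnegrE ?mulr_ge0 ?sqrtr_ge0 ?(ltW k0) ?(ltW nc0)//.
    lra.
  by rewrite exprMn sqr_sqrtr// sqrrN mulrC.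
rewrite lee_fin ler_pdivrMr; last by rewrite ltr_pwDl// sqr_ge0.
rewrite mulrC ler_pdivlMr//; lra.
Qed.

End RandomVariables.

(** * Mean, covariance and pseudo-covariance of laws on C^k *)

Section Laws.
Local Open Scope complex_scope.
Context {R : realType} {k : nat}.
Implicit Type F : probability (cvec R k) R.

Lemma measurable_reim j :
  measurable_fun setT (fun d : cvec R k => reim d j 0 : measurableTypeR R).
Proof.
move=> _ B mB; apply: sub_sigma_algebra.
rewrite (bigD1 j)//=; left.
by exists B.
Qed.

Lemma reim_lshift (d : 'rV[R[i]]_k) j : reim d (lshift k j) 0 = complex.Re (d 0 j).
Proof. by rewrite /reim col_mxEu !mxE. Qed.

Lemma reim_rshift (d : 'rV[R[i]]_k) j : reim d (rshift k j) 0 = complex.Im (d 0 j).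
Proof. by rewrite /reim col_mxEd !mxE. Qed.

Lemma reimD (c d : 'rV[R[i]]_k) : reim (c + d) = reim c + reim d.
Proof.
rewrite /reim -[RHS]/(_ + _) add_col_mx; congr col_mx;
  by apply/matrixP => i j; rewrite !mxE; case: (c _ _); case: (d _ _).
Qed.

Lemma reimN (d : 'rV[R[i]]_k) : reim (- d) = - reim d.
Proof.
rewrite /reim opp_col_mx; congr col_mx;
  by apply/matrixP => i j; rewrite !mxE; case: (d _ _).
Qed.

Lemma reim_mean F j : reim (mean F) j 0 = fine 'E_F[fun d => reim d j 0].
Proof.
rewrite -[j]fintype.splitK; case: (fintype.split j) => l /=;
  rewrite ?reim_lshift ?reim_rshift mxE /=; congr (fine (expectation _ _));
  by apply/funext => d; rewrite ?reim_lshift ?reim_rshift.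
Qed.

Section Pairing.
Variable x : 'cV[R[i]]_k.
Let w := reim (map_mx Num.conj x)^T.

Let Repair_sum : (fun d : cvec R k => Repair d x) =
  (fun d => \sum_j w j 0 * reim d j 0).
Proof.
by apply/funext => d; rewrite RepairE mxE; apply: eq_bigr => j _; rewrite mxE.
Qed.

Lemma Lfun2_Repair F : square_integrable F ->
  (fun d : cvec R k => Repair d x) \in Lfun F 2%:E.
Proof. by move=> F2; rewrite Repair_sum; exact: Lfun2_lincomb. Qed.

Lemma expectation_Repair F : square_integrable F ->
  fine 'E_F[fun d => Repair d x] = Repair (mean F) x.
Proof.
move=> F2; have /= -> := congr1 (@^~ (mean F)) Repair_sum.
rewrite Repair_sum (expectation_lincomb _ F2).
by apply: eq_bigr => j _; rewrite reim_mean.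
Qed.

Lemma variance_Repair F : square_integrable F ->
  fine 'V_F[fun d => Repair d x] = qform (covmx F) w.
Proof.
move=> F2; rewrite Repair_sum (variance_lincomb _ F2) /qform /bform mxE.
rewrite exchange_big; apply: eq_bigr => l _.
rewrite [(_ *m _) _ _]mxE mulr_suml; apply: eq_bigr => j _.
by rewrite [in RHS]mxE [covmx _ _ _]mxE mulrAC.
Qed.

End Pairing.

(** The pseudo-covariance of a square integrable law is [Jmx] of its covariance matrix: expanding
    the product of two centered complex coordinates gives Cov(R,R) - Cov(I,I) as real part and
    Cov(I,R) + Cov(R,I) as imaginary part. *)
Lemma proper_Jmx F : square_integrable F -> proper_law F -> Jmx (covmx F) = 0.
Proof.
move=> F2 <-; rewrite JmxE; apply/matrixP => j l.
pose X (c : 'I_(k + k)) (d : cvec R k) := reim d c 0.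
have X2 c : X c \in Lfun F 2%:E by exact: F2.
pose Y (c : 'I_(k + k)) := X c \- cst (fine 'E_F[X c]).
have YY c e : Y c * Y e \in Lfun F 1.
  have Y2 c' : Y c' \in Lfun F 2%:E.
    have -> : Y c' = X c' \+ cst (- fine 'E_F[X c']) by [].
    by rewrite Lfun2D// Lfun_cst.
  exact: Lfun2M.
have covY c e : 'E_F[Y c * Y e]%E = covariance F (X c) (X e).
  by rewrite [in RHS]unlock.
have fY c e : 'E_F[Y c * Y e]%E \is a fin_num by rewrite expectation_fin_num.
have YE (d : cvec R k) c : reim ((d : 'rV[R[i]]_k) - mean F) c 0 = Y c d.
  by rewrite reimD reimN entryD entryN reim_mean.
rewrite [RHS]mxE /Cexpectation.
have -> : (fun d : cvec R k => complex.Re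
    (((d : 'rV[R[i]]_k) - mean F) 0 j * ((d : 'rV[R[i]]_k) - mean F) 0 l)) =
    (Y (lshift k j) * Y (lshift k l)) \- (Y (rshift k j) * Y (rshift k l)).
  apply/funext => d /=; rewrite !fctE -!YE !reim_lshift !reim_rshift.
  by case: (_ 0 j) => a b; case: (_ 0 l) => a' b'.
have -> : (fun d : cvec R k => complex.Im
    (((d : 'rV[R[i]]_k) - mean F) 0 j * ((d : 'rV[R[i]]_k) - mean F) 0 l)) =
    (Y (rshift k j) * Y (lshift k l)) \+ (Y (lshift k j) * Y (rshift k l)).
  apply/funext => d /=; rewrite !fctE -!YE !reim_lshift !reim_rshift.
  by case: (_ 0 j) => a b; case: (_ 0 l) => a' b' /=; rewrite addrC.
rewrite expectationB// expectationD// fineB// fineD// !covY.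
by rewrite !mxE.
Qed.

End Laws.

(** * Two-point distributions on a measurable space *)

Section TwoPoint.
Context {R : realType} {d : measure_display} {T : measurableType d}.
Variables (q : R) (q01 : 0 <= q <= 1) (f : bool -> T).

Let mf : measurable_fun setT f. Proof. by []. Qed.

(** As a push-forward from [bool], where every function is measurable, the law can have arbitrary
    atoms: [f true] receives mass q and [f false] mass 1 - q. *)
Definition two_point : probability T R :=
  distribution (bernoulli_prob q) (mfun_Sub (mem_set mf)).

Lemma Lfun_two_point (X : T -> R) : measurable_fun setT X ->
  X \in Lfun two_point 2%:E.
Proof.
move=> mX; apply/andP; split; rewrite inE// /finite_norm/= unlock /Lnorm.
apply: poweR_lty.
rewrite ge0_integral_distribution//; last 2 first.
- apply/measurable_EFinP.
  apply/(@measurableT_comp _ _ _ _ _ _ (fun x : R => x `^ 2)%R) => //.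
  exact/measurableT_comp.
- by move=> t; rewrite lee_fin powR_ge0.
by rewrite integral_bernoulli_prob//= ?ltry// => b; rewrite lee_fin powR_ge0.
Qed.

Lemma expectation_two_point (X : T -> R) : measurable_fun setT X ->
  ('E_two_point[X] = (q * X (f true) + (1 - q) * X (f false))%:E)%E.
Proof.
move=> mX; have X2 := Lfun_two_point mX.
(* Bernoulli integrals are computed for nonnegative functions. Adding the constant M makes X
   nonnegative at both atoms; it is cancelled at the end by linearity. *)
pose M := `|X (f true)| + `|X (f false)|.
have M0 b : 0 <= X (f b) + M.
  rewrite /M; have := ler_norm (- X (f b)); rewrite normrN.
  by case: b; have := normr_ge0 (X (f true)); have := normr_ge0 (X (f false)); lra.
have EM : ('E_two_point[X \+ cst M] = (q * X (f true) + (1 - q) * X (f false) + M)%:E)%E.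
  rewrite unlock.
  have mXM : measurable_fun setT (EFin \o (X \+ cst M)).
    by apply/measurable_EFinP; exact: measurable_funD.
  have intXM : (bernoulli_prob q).-integrable setT ((EFin \o (X \+ cst M)) \o f).
    apply/integrableP; split=> //.
    by rewrite integral_bernoulli_prob//= ltry.
  rewrite integral_distribution// integral_bernoulli_prob//=.
  rewrite -!EFinM -EFinD /unstable.onem; congr EFin; ring.
have X1 := Lfun21 X2.
have := EM; rewrite expectationD ?Lfun_cst// expectation_cst.
rewrite -(fineK (expectation_fin_num X1)) -EFinD => -[] /addIr ->.
by [].
Qed.

Lemma two_point_le A : ~ A (f true) -> (two_point A <= (1 - q)%:E)%E.
Proof.
move=> nA.
have -> : two_point A = bernoulli_prob q (f @^-1` A) by [].
rewrite bernoulli_probE//.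
rewrite !diracE memNset//= mule0 add0e.
case: (_ \in _); rewrite ?mule1// mule0 lee_fin.
by case/andP: q01; rewrite subr_ge0.
Qed.

End TwoPoint.

(** * Two-point laws on C^k with prescribed mean and rank-one covariance *)

Section TwoPointLaw.
Context {R : realType} {k : nat}.

Definition unreim (g : 'cV[R]_(k + k)) : 'rV[R[i]]_k :=
  (cmx (usubmx g) (dsubmx g))^T.

Lemma unreimK g : reim (unreim g) = g.
Proof.
by rewrite /reim /unreim tr_cmx Re_cmx Im_cmx !trmxK vsubmxK.
Qed.

Lemma reimI : injective (@reim R k).
Proof.
move=> c e ce; apply/rowP => j.
have := congr1 (fun v : 'cV__ => v (lshift k j) 0) ce.
have := congr1 (fun v : 'cV__ => v (rshift k j) 0) ce.
rewrite !reim_lshift !reim_rshift.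
by case: (c 0 j) => a b; case: (e 0 j) => a' b' /= -> ->.
Qed.

(** The law is that of c + xi g, with xi equal to t with probability 1 / (1 + t^2) and to -1/t
    otherwise. An event that misses the atom at t can only carry the mass t^2 / (1 + t^2) of the
    other atom. *)
Lemma two_point_law (c : 'rV[R[i]]_k) (g : 'cV[R]_(k + k)) (t : R) : 0 < t ->
  exists F : probability (cvec R k) R,
  [/\ square_integrable F, mean F = c, covmx F = g *m g^T &
    forall A : set (cvec R k), ~ A (c + unreim (t *: g)) ->
      (F A <= (t ^+ 2 / (1 + t ^+ 2))%:E)%E].
Proof.
move=> t0; have tn0 : t != 0 by rewrite gt_eqF.
have D0 : 0 < 1 + t ^+ 2 by rewrite ltr_wpDr ?exprn_ge0// ltW.
have Dn0 : 1 + t ^+ 2 != 0 by rewrite gt_eqF.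
(* This weight makes xi centered, as q t = (1 - q) / t, and of variance q t^2 + (1 - q) / t^2 =
   1. *)
pose q := (1 + t ^+ 2)^-1.
have q01 : 0 <= q <= 1.
  by rewrite invr_ge0 (ltW D0) invf_le1// lerDl sqr_ge0.
pose xi (b : bool) := if b then t else - t^-1.
pose f b : cvec R k := c + unreim (xi b *: g).
pose F : probability (cvec R k) R := two_point q f.
have fE b j : reim (f b) j 0 = reim c j 0 + xi b * g j 0.
  by rewrite /f reimD unreimK entryD entryZ.
have EX j : 'E_F[fun d => (reim d j 0)%R]%E = (reim c j 0)%:E.
  rewrite expectation_two_point//; last exact: measurable_reim.
  by congr EFin; rewrite !fE /xi /q; field; rewrite ?Dn0 ?tn0.
exists F; split.
- by move=> j; apply: Lfun_two_point => //; exact: measurable_reim.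
- by apply: reimI; apply/colP => j; rewrite reim_mean EX.
- apply/matrixP => j l; rewrite mxE unlock !EX.
  rewrite expectation_two_point//; last first.
    by apply: measurable_funM; apply: measurable_funB => //; exact: measurable_reim.
  rewrite !fctE /= !fE [RHS]mxE big_ord1 [g^T _ _]mxE /xi /q /=.
  by field; rewrite ?Dn0 ?tn0.
- move=> A nA; rewrite (_ : t ^+ 2 / _ = 1 - q); last by rewrite /q; field.
  exact: two_point_le.
Qed.

End TwoPointLaw.

(** * The worst direction of fluctuation *)

Section WorstCase.
Context {R : realType} {k : nat}.
Variables (L : 'M[R]_(k + k)) (w : 'cV[R]_(k + k)).
Hypothesis L_psd : psd L.

Let sigma := Num.sqrt (qform L w).
(* When sigma = 0, the convention 0^-1 = 0 gives g = 0, as needed. *)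
Let g := sigma^-1 *: (L *m w).

Let qform_sigma : qform L w = sigma ^+ 2.
Proof. by rewrite sqr_sqrtr//; apply: L_psd.2. Qed.

Lemma worst_direction_pairing : (w^T *m g) 0 0 = sigma.
Proof.
rewrite /g -scalemxAr entryZ mulmxA -/(bform L w w) -/(qform L w) qform_sigma.
have [->|s0] := eqVneq sigma 0; first by rewrite invr0 mul0r.
by rewrite expr2 mulKf.
Qed.

(** At y the form of g g^T is (w^T L y)^2 / (w^T L w), which the Cauchy-Schwarz inequality for [L]
    bounds by y^T L y. *)
Lemma worst_direction_loewner : loewner_le (g *m g^T) L.
Proof.
case: (L_psd) => Lsym Lge0; split.
  by rewrite linearB/= trmx_mul trmxK Lsym.
move=> y; rewrite -/(bform _ _ _) bformDm bformNm subr_ge0.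
have -> : bform (g *m g^T) y y = sigma^-1 ^+ 2 * bform L w y ^+ 2.
  have gy : (g^T *m y) 0 0 = sigma^-1 * bform L w y.
    by rewrite /g linearZ/= -scalemxAl entryZ trmx_mul Lsym.
  rewrite [LHS]/bform mulmxA -mulmxA mxE big_ord1 gy.
  have -> : (y^T *m g) 0 0 = (g^T *m y) 0 0.
    by rewrite -[in RHS](trmxK y) -trmx_mul [RHS]mxE.
  by rewrite gy; ring.
have [->|s0] := eqVneq sigma 0; first by rewrite invr0 expr0n mul0r; apply: Lge0.
rewrite exprVn mulrC ler_pdivrMr; last by rewrite exprn_even_gt0.
by rewrite mulrC -qform_sigma; apply: psd_CauchySchwarz.
Qed.

End WorstCase.

(** * Scalar facts about the Cantelli bound *)

Lemma odds_ratioK (R : realType) (p : R) : 0 < p < 1 ->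
  let kappa := Num.sqrt (p / (1 - p)) in
  0 < kappa /\ kappa ^+ 2 / (1 + kappa ^+ 2) = p.
Proof.
move=> /andP[p0 p1] kappa.
have q0 : 0 < 1 - p by rewrite subr_gt0.
have r0 : 0 < p / (1 - p) by rewrite divr_gt0.
split; first by rewrite sqrtr_gt0.
rewrite sqr_sqrtr ?ltW//; field; rewrite gt_eqF//=.
by rewrite subrK oner_neq0.
Qed.

(** At slope kappa itself the two-point law may still give the event probability p, which is no
    contradiction. A strict violation leaves room for a smaller slope, and hence for a probability
    below p. *)
Lemma exists_smaller_slope (R : realType) (m s kappa : R) :
  0 <= s -> 0 < kappa -> 0 < m + kappa * s ->
  exists t, [/\ 0 < t, t < kappa & 0 < m + t * s].
Proof.
move=> s0 k0 h; have [m0|m0] := ltP 0 m.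
  exists (kappa / 2); split; [lra|lra|].
  by rewrite ltr_pwDl// mulr_ge0//; lra.
have sp : 0 < s.
  by rewrite lt_def s0 andbT; apply/eqP => s00; move: h; rewrite s00; lra.
(* The midpoint between kappa and the zero -m / s of the map sending t to m + t s. *)
exists ((- m / s + kappa) / 2).
have ms0 : 0 <= - m / s by rewrite divr_ge0 ?oppr_ge0.
have msk : - m / s < kappa by rewrite ltr_pdivrMr//; lra.
split; [lra|lra|].
have -> : m + (- m / s + kappa) / 2 * s = (m + kappa * s) / 2.
  by field; rewrite gt_eqF.
lra.
Qed.

Lemma odds_lt (R : realType) (t u : R) : 0 < t -> t < u ->
  t ^+ 2 / (1 + t ^+ 2) < u ^+ 2 / (1 + u ^+ 2).
Proof.
move=> t0 tu; have tu2 : t ^+ 2 < u ^+ 2 by nra.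
have := sqr_ge0 t => t2; have := sqr_ge0 u => u2.
rewrite ltr_pdivrMr ?ltr_pwDl// mulrAC ltr_pdivlMr ?ltr_pwDl//; lra.
Qed.

(** * The equivalence for a single constraint, and its proper case *)

Lemma RepairD (R : realType) k (c e : 'rV[R[i]]_k) x :
  Repair (c + e) x = Repair c x + Repair e x.
Proof. by rewrite !RepairE reimD mulmxDr entryD. Qed.

Lemma robust_chance_constraint (R : realType) k (x : 'cV[R[i]]_k) mu zeta
    (L : 'M[R]_(k + k)) p :
    0 <= zeta -> psd L -> Gamma L \in unitmx -> 0 < p < 1 ->
  (p%:E <= ereal_inf [set F [set d : cvec R k | (Repair d x <= 0)%R]
                     | F in ambiguity_set mu zeta L])%E <->
  Repair mu x + Num.sqrt zeta * Num.sqrt (Gammaform L x)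
    + Num.sqrt (p / (1 - p)) * Num.sqrt (2^-1 * (Gammaform L x + Jform L x)) <= 0.
Proof.
move=> z0 L_psd Gu p01.
have [] := odds_ratioK p01; set kappa := Num.sqrt (p / _) => k0 kp.
rewrite Gamma_Jform ?mulKf ?pnatr_eq0//; last by case: L_psd.
set w := reim _; set sigma := Num.sqrt (qform L w).
set rho := Num.sqrt zeta * _.
split=> h.
  rewrite leNgt; apply/negP => worst.
  (* Necessity: a law feasible for the ambiguity set is built from the violated inequality. *)
  have [t [t0 tk tpos]] := exists_smaller_slope (sqrtr_ge0 _) k0 worst.
  have [v [vz vrho]] := Repair_attained x L_psd Gu z0.
  pose g := sigma^-1 *: (L *m w).
  have [F [F2 Fmean Fcov Fle]] := two_point_law (mu + v) g t0.
  have : (p%:E <= F [set d : cvec R k | (Repair d x <= 0)%R])%E.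
    apply: (le_trans h); apply: ereal_inf_lbound; exists F => //; split=> //.
      by rewrite Fmean addrC addKr.
    by rewrite Fcov; apply: worst_direction_loewner.
  apply/negP; rewrite -ltNge; apply: le_lt_trans (Fle _ _) _.
    (* The atom [mu + v + unreim (t *: g)] pairs with x to [Repair mu x + rho + t * sigma], which is
       positive, so it lies outside the event. *)
    rewrite /= !RepairD vrho -/rho.
    rewrite (RepairE (unreim _)) unreimK -/w -scalemxAr entryZ.
    rewrite worst_direction_pairing// -/sigma.
    by apply/negP; rewrite -ltNge.
  by rewrite lte_fin -kp odds_lt.
(* Sufficiency: the infimum is bounded law by law, comparing the mean with [Repair mu x + rho] and
   the variance with [qform L w]. *)
apply: le_ereal_inf_tmp => _ [F [F2 Fmean Fcov] <-].
rewrite -kp; apply: robust_cantelli => //; first exact: Lfun2_Repair.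
rewrite expectation_Repair// variance_Repair// -/w.
apply: le_trans h; apply: lerD.
  rewrite -[mean F](subrK mu) RepairD addrC lerD2l.
  exact: Repair_le Fmean.
rewrite ler_wpM2l ?(ltW k0)//; apply: ler_wsqrtr.
have := Fcov.2 w; rewrite -/(bform _ _ _) bformDm bformNm.
by rewrite subr_ge0.
Qed.

(** With J = 0 the factor 1/2 leaves the last radicand and joins p / (1 - p) under the other root,
    so that the root of the form of Gamma factors out. *)
Lemma robust_ineq_proper (R : realType) k (x : 'cV[R[i]]_k) (r zeta p : R)
    (L : 'M[R]_(k + k)) : 0 < p < 1 -> Jmx L = 0 ->
  r + Num.sqrt zeta * Num.sqrt (Gammaform L x)
    + Num.sqrt (p / (1 - p)) * Num.sqrt (2^-1 * (Gammaform L x + Jform L x)) =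
  r + (Num.sqrt zeta + Num.sqrt (p / (2 * (1 - p)))) * Num.sqrt (Gammaform L x).
Proof.
move=> /andP[p0 p1] J0; have -> : Jform L x = 0.
  by rewrite /Jform J0 mulmx0 mul0mx mxE.
rewrite addr0 (@sqrtrM _ 2^-1) ?invr_ge0 ?ler0n// mulrDl -addrA mulrA.
rewrite -(@sqrtrM _ (p / (1 - p))); last first.
  by rewrite divr_ge0 ?subr_ge0// ltW.
congr (_ + (_ + Num.sqrt _ * _)).
by field; rewrite gt_eqF ?subr_gt0.
Qed.

Theorem theorem5p5 (R : realType) (n m : nat) (z : 'cV[R[i]]_n)
    (mu : 'I_m -> 'rV[R[i]]_(n + 1)) (zeta : 'I_m -> R)
    (L : 'I_m -> 'M[R]_((n + 1) + (n + 1))) (p : 'I_m -> R)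
    (zeta_ge0 : forall i, 0 <= zeta i)
    (L_psd : forall i, psd (L i))
    (Gamma_unit : forall i, Gamma (L i) \in unitmx)
    (p01 : forall i, 0 < p i < 1) :
  let zt : 'cV[R[i]]_(n + 1) := homogenize z in
  let robust_ineq (i : 'I_m) : Prop :=
    Repair (mu i) zt
    + Num.sqrt (zeta i) * Num.sqrt (Gammaform (L i) zt)
    + Num.sqrt (p i / (1 - p i))
      * Num.sqrt (2^-1 * (Gammaform (L i) zt + Jform (L i) zt)) <= 0 in
  let proper_ineq (i : 'I_m) : Prop :=
    Repair (mu i) zt
    + (Num.sqrt (zeta i) + Num.sqrt (p i / (2 * (1 - p i))))
      * Num.sqrt (Gammaform (L i) zt) <= 0 in
  [/\ forall i : 'I_m,
        ((p i)%:E <= ereal_inf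
           [set F [set d : cvec R (n + 1) | (Repair d zt <= 0)%R]
           | F in ambiguity_set (mu i) (zeta i) (L i)])%E
        <-> robust_ineq i,
      forall (i : 'I_m) (F : probability (cvec R (n + 1)) R),
        square_integrable F -> covmx F = L i -> proper_law F -> Jmx (L i) = 0
    & forall i : 'I_m, Jmx (L i) = 0 -> (robust_ineq i <-> proper_ineq i)].
Proof.
move=> zt robust_ineq proper_ineq; split=> [i|i F F2 <-|i J0].
- exact: robust_chance_constraint.
- exact: proper_Jmx.
- by rewrite /robust_ineq robust_ineq_proper.
Qed.
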